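(* Let $X$ be a nonempty set and let $\leq$ be a total ordering on $X$. An operation $F\colon X^2\to X$ is associative, quasitrivial, and $\leq$-preserving if and only if there exists a weak ordering $\precsim$ on $X$ that is weakly single-peaked for $\leq$ and such that, for all equivalence classes $A,B\in X/{\sim}$, $$F|_{A\times B}=\begin{cases}\max_{\precsim}|_{A\times B}, & \text{if } A\neq B,\\ \pi_1|_{A\times B}\ \text{ or }\ \pi_2|_{A\times B}, & \text{if } A=B.\end{cases}$$
   Context: A total ordering on $X$ is a binary relation on $X$ that is total (hence reflexive), transitive, and antisymmetric; a weak ordering $\precsim$ on $X$ is a total and transitive binary relation. Its symmetric part is denoted $\sim$ (an equivalence relation: $x\sim y$ iff $x\precsim y$ and $y\precsim x$) and its asymmetric part $\prec$ ($x\prec y$ iff $x\precsim y$ and not $y\precsim x$). For $x,y$ in distinct $\sim$-classes, $\max_{\precsim}(x,y)=\max_{\precsim}(y,x)=y$ whenever $x\prec y$. The projections are $\pi_1(x,y)=x$ and $\pi_2(x,y)=y$; in the case $A=B$ of the displayed formula, the choice of projection may depend on the class $A$. Given a total ordering $\leq$ on $X$, a weak ordering $\precsim$ on $X$ is weakly single-peaked for $\leq$ if for any $a,b,c\in X$ such that $a<b<c$, we have $b\prec a$ or $b\prec c$ or $a\sim b\sim c$. $F$ is associative if $F(F(x,y),z)=F(x,F(y,z))$ for all $x,y,z$; quasitrivial if $F(x,y)\in\{x,y\}$ for all $x,y$; $\leq$-preserving if $x\leq x'$ and $y\leq y'$ imply $F(x,y)\leq F(x',y')$. *)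

(* Defs.v *)
From Corelib Require Relation_Definitions.
From mathcomp Require Import all_boot.
From mathcomp Require Import boolp classical_sets.

Set Implicit Arguments.
Unset Strict Implicit.
Unset Printing Implicit Defensive.

Local Open Scope classical_set_scope.

Section Orderings.
Variable X : Type.
Implicit Types (R le : X -> X -> Prop) (x y z a b c : X).

Definition total_rel R := forall x y, R x y \/ R y x.

Definition weak_ordering R :=
  total_rel R /\ Relation_Definitions.transitive X R.

Definition total_ordering R :=
  [/\ total_rel R, Relation_Definitions.transitive X R
    & Relation_Definitions.antisymmetric X R].

Definition sym_part R x y := R x y /\ R y x.

(* For a total ordering this is the usual strict order. *)
Definition asym_part R x y := R x y /\ ~ R y x.

(* The quotient of X by the symmetric part of R, as a set of subsets of X. *)
Definition quotient_classes R : set (set X) :=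
  range (fun x => [set y | sym_part R x y]).

(* The maximum is only meaningful for x and y in distinct classes; when they
   lie in the same class this returns x as a dummy value. *)
Definition max_wrt R x y : X := if `[< asym_part R x y >] then y else x.

Definition weakly_single_peaked le R :=
  forall a b c, asym_part le a b -> asym_part le b c ->
    [\/ asym_part R b a, asym_part R b c | sym_part R a b /\ sym_part R b c].

End Orderings.

Section Operations.
Variable X : Type.
Implicit Types (F G : X -> X -> X) (le : X -> X -> Prop) (A B : set X).

Definition quasitrivial F := forall x y, F x y = x \/ F x y = y.

Definition order_preserving le F :=
  forall x x' y y', le x x' -> le y y' -> le (F x y) (F x' y').

Definition proj1_op (x y : X) : X := x.
Definition proj2_op (x y : X) : X := y.

Definition eq_on_prod A B F G := forall x y, A x -> B y -> F x y = G x y.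

End Operations.

(* Main.v *)
Require Import Defs.
From mathcomp Require Import all_boot.
From mathcomp Require Import boolp classical_sets.

(** An associative quasitrivial operation [F] determines the weak ordering
    [x ≼ y] iff [F x y = y] or [F y x = y] (Kimura): distinct equivalent
    elements are exactly those that do not commute, and on an equivalence class
    associativity forces a single projection.  Conversely, when an [F] given by
    such an ordering fails to be monotone in one argument, the failure is
    witnessed by three elements whose middle one is a ≼-upper bound of the other
    two; weak single-peakedness then puts all three in one class, on which [F]
    would have to act as both projections. *)

Local Open Scope classical_set_scope.

(** * Weak orderings, their strict and symmetric parts, and their classes *)

Section WeakOrdering.
Variables (X : Type) (R : X -> X -> Prop).
Hypothesis hR : weak_ordering R.
Implicit Types x y z : X.

Lemma weak_ordering_refl x : R x x.
Proof. by case: (hR.1 x x). Qed.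

Lemma weak_ordering_trans y x z : R x y -> R y z -> R x z.
Proof. exact: hR.2. Qed.

Lemma sym_part_refl x : sym_part R x x.
Proof. by split; exact: weak_ordering_refl. Qed.

Lemma sym_part_sym x y : sym_part R x y -> sym_part R y x.
Proof. by case. Qed.

Lemma sym_part_trans y x z : sym_part R x y -> sym_part R y z -> sym_part R x z.
Proof.
by move=> [xy yx] [yz zy]; split; [exact: (weak_ordering_trans y) |
  exact: (weak_ordering_trans y)].
Qed.

Lemma asym_part_le_trans y x z : asym_part R x y -> R y z -> asym_part R x z.
Proof.
move=> [xy nyx] yz; split; first exact: (weak_ordering_trans y).
by move=> zx; apply: nyx; exact: (weak_ordering_trans z).
Qed.

Lemma le_asym_part_trans y x z : R x y -> asym_part R y z -> asym_part R x z.
Proof.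
move=> xy [yz nzy]; split; first exact: (weak_ordering_trans y).
by move=> zx; apply: nzy; exact: (weak_ordering_trans x).
Qed.

Lemma not_weak_ordering x y : ~ R x y -> asym_part R y x.
Proof. by case: (hR.1 x y). Qed.

Lemma weak_ordering_trichotomy x y :
  [\/ asym_part R x y, sym_part R x y | asym_part R y x].
Proof.
have [xy|/not_weak_ordering ?] := EM (R x y); last exact: Or33.
have [yx|/not_weak_ordering ?] := EM (R y x); last exact: Or31.
exact: Or32.
Qed.

Lemma sym_part_class_eq x y :
  [set t | sym_part R x t] = [set t | sym_part R y t] <-> sym_part R x y.
Proof.
split=> [e|xy].
  have : [set t | sym_part R y t] y by exact: sym_part_refl.
  by rewrite -e.
apply/seteqP; split=> t /= h.
  by apply: (sym_part_trans x) => //; exact: sym_part_sym.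
exact: (sym_part_trans y).
Qed.

End WeakOrdering.

(* Element-wise form of the displayed formula for [F] on products of classes. *)
Definition max_or_proj {X : Type} (R : X -> X -> Prop) (F : X -> X -> X) :=
  (forall x y, asym_part R x y -> F x y = y /\ F y x = y) /\
  (forall x, (forall y z, sym_part R x y -> sym_part R x z -> F y z = y) \/
             (forall y z, sym_part R x y -> sym_part R x z -> F y z = z)).

Lemma max_wrt_asym (X : Type) (R : X -> X -> Prop) x y :
  asym_part R x y -> max_wrt R x y = y /\ max_wrt R y x = y.
Proof.
move=> xy; rewrite /max_wrt asboolT //; split=> //.
by rewrite asboolF // => -[yx _]; case: xy.
Qed.

(** Removes the quotient from the problem: each class has a representative, and elements of distinct
    classes are strictly comparable, so [max_wrt] never takes its dummy value there. *)
Lemma max_or_proj_classesP (X : Type) (R : X -> X -> Prop) (F : X -> X -> X) :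
  weak_ordering R ->
  (forall A B : set X, quotient_classes R A -> quotient_classes R B ->
     (A <> B -> eq_on_prod A B F (max_wrt R)) /\
     (A = B -> eq_on_prod A B F (@proj1_op X) \/
               eq_on_prod A B F (@proj2_op X))) <->
  max_or_proj R F.
Proof.
move=> hR; pose cls x := [set t | sym_part R x t].
have clsP x : quotient_classes R (cls x) by exists x.
have cls_refl x : cls x x by exact: sym_part_refl.
split=> [h|[hmax hproj] A B [x _ <-] [y _ <-]].
  split=> [x y xy|x].
    have [mxy myx] := max_wrt_asym _ _ _ _ xy.
    have ne : cls x <> cls y by move/(sym_part_class_eq X R hR)=> [_ yx]; case: xy.
    split; first by rewrite ((h _ _ (clsP x) (clsP y)).1 ne).
    by rewrite ((h _ _ (clsP y) (clsP x)).1 (nesym ne)).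
  by have [k|k] := (h _ _ (clsP x) (clsP x)).2 erefl; [left|right] => y z;
    exact: k.
split=> [ne u v /= xu yv|/(sym_part_class_eq X R hR) xy].
  have nuv : ~ sym_part R u v.
    move=> uv; apply/ne/(sym_part_class_eq X R hR).
    apply: (sym_part_trans X R hR u) => //; apply: (sym_part_trans X R hR v) => //.
    exact: sym_part_sym.
  by case: (weak_ordering_trichotomy X R hR u v) => // uv;
    have [e1 e2] := max_wrt_asym _ _ _ _ uv; have [? ?] := hmax _ _ uv; congruence.
by case: (hproj x) => k; [left|right] => u v /= xu yv; apply: k => //;
  exact: (sym_part_trans X R hR y).
Qed.

(** * From an associative quasitrivial operation to its weak ordering *)

Section Kimura.
Variables (X : Type) (F : X -> X -> X).
Hypotheses (FA : associative F) (Fq : quasitrivial F).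

Definition kimura_order x y := F x y = y \/ F y x = y.
Local Notation R := kimura_order.

Lemma kimura_order_weak : weak_ordering R.
Proof.
split=> [x y|x y z].
  by case: (Fq x y); [right; right | left; left].
have [xz|xz] := Fq x z; last by left.
have [zx|zx] := Fq z x; first by right.
(* What remains is [F x z = F z x = x]. If both comparisons hold on the same side, associativity
   carries [z] through; in the two mixed cases it forces [y = z]. *)
case=> [xy|yx] [yz|zy].
- by left; rewrite -{1}yz FA xy.
- by have := FA z x y; rewrite zx xy zy => ->; left.
- by have := FA y x z; rewrite yx xz yz yx => <-; right.
- by right; rewrite -{1}zy -FA yx.
Qed.

Lemma kimura_order_asym x y : asym_part R x y -> F x y = y /\ F y x = y.
Proof. by rewrite /asym_part /R; case: (Fq x y); case: (Fq y x); tauto. Qed.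

Lemma kimura_order_sym x y : sym_part R x y ->
  (F x y = x /\ F y x = y) \/ (F x y = y /\ F y x = x).
Proof.
rewrite /sym_part /R.
by case: (Fq x y) => e1; case: (Fq y x) => e2 [] [] ? [] ?; intuition congruence.
Qed.

(** Otherwise [F x z = z] and [F z x = x]. If [F z y = z], associativity on [z, y, x] collapses [z]
    to [x]; if [F z y = y], associativity on [x, z, y] collapses [x] to [y]. *)
Lemma kimura_order_proj1 x y z : sym_part R x y -> sym_part R x z ->
  x <> y -> F x y = x -> F x z = x.
Proof.
move=> xy xz ne Fxy.
have [[//]|[Fxz Fzx]] := kimura_order_sym _ _ xz.
have Fyx : F y x = y by have [[]|[]] := kimura_order_sym _ _ xy; congruence.
have yz : sym_part R y z.
  by apply: (sym_part_trans _ _ kimura_order_weak x) => //; exact: sym_part_sym.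
have [[_ Fzy]|[_ Fzy]] := kimura_order_sym _ _ yz.
  by have := FA z y x; rewrite Fyx Fzy Fzx Fxz.
by have := FA x z y; rewrite Fzy Fxy Fxz Fzy.
Qed.

Lemma kimura_order_max_or_proj : max_or_proj R F.
Proof.
have hR := kimura_order_weak.
split=> [|c]; first exact: kimura_order_asym.
have [[u [v [cu cv uv]]]|nproj1] :=
    EM (exists u v, [/\ sym_part R c u, sym_part R c v & F u v <> u]); last first.
  left=> u v cu cv; apply: contrapT => uv; apply: nproj1.
  by exists u, v.
(* A pair with [F x y = x] and [x <> y] would spread the first projection from [x] to [u]:
   [F x u = x], hence [F u x = u], hence [F u v = u], against the choice of [u] and [v]. *)
right=> x y cx cy; have [Fxy|//] := Fq x y.
have same s t : sym_part R c s -> sym_part R c t -> sym_part R s t.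
  by move=> cs ct; apply: (sym_part_trans _ _ hR c) => //; exact: sym_part_sym.
have [->|xy] := EM (x = y); first by case: (Fq y y).
have Fxu : F x u = x by apply: (kimura_order_proj1 x y) => //; exact: same.
have [xu|xu] := EM (x = u).
  by case: uv; rewrite -xu in cu *; apply: (kimura_order_proj1 x y) => //;
    exact: same.
have Fux : F u x = u by have [[]|[]] := kimura_order_sym x u (same _ _ cx cu); congruence.
by case: uv; apply: (kimura_order_proj1 u x) => //; [exact: same..|exact: nesym].
Qed.

End Kimura.

(** Monotonicity gives [F a c] above [F a b = b], so it cannot be [a] and must be [c]. Then [F b c]
    lies above [F a c = c], so it cannot be [b]. The same holds with the arguments exchanged. *)
Lemma order_preserving_no_strict_peak (X : Type) (le : X -> X -> Prop)
    (F : X -> X -> X) a b c :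
  total_rel le -> quasitrivial F -> order_preserving le F ->
  asym_part le a b -> asym_part le b c ->
  asym_part (kimura_order X F) a b -> ~ kimura_order X F c b.
Proof.
move=> tot Fq Fle [ab nba] [bc ncb] /(kimura_order_asym _ _ Fq) [Fab Fba].
have refl x : le x x by case: (tot x x).
have Fac : F a c = c.
  by case: (Fq a c) => // e; case: nba; rewrite -Fab -[X in le _ X]e; exact: Fle.
have Fca : F c a = c.
  by case: (Fq c a) => // e; case: nba; rewrite -Fba -[X in le _ X]e; exact: Fle.
have Fbc : F b c <> b.
  by move=> e; case: ncb; rewrite -e -[X in le X _]Fac; exact: Fle.
have Fcb : F c b <> b.
  by move=> e; case: ncb; rewrite -e -[X in le X _]Fca; exact: Fle.
by case.
Qed.

Lemma kimura_order_weakly_single_peaked (X : Type) (le : X -> X -> Prop)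
    (F : X -> X -> X) :
  total_rel le -> associative F -> quasitrivial F -> order_preserving le F ->
  weakly_single_peaked le (kimura_order X F).
Proof.
move=> tot FA Fq Fle a b c ab bc.
have hR := kimura_order_weak _ _ FA Fq.
have [Rab|/(not_weak_ordering _ _ hR)] := EM (kimura_order X F a b); last exact: Or31.
have [Rcb|/(not_weak_ordering _ _ hR)] := EM (kimura_order X F c b); last exact: Or32.
apply: Or33; split; split => //; apply: contrapT => n.
  exact: (order_preserving_no_strict_peak _ _ _ _ _ _ tot Fq Fle ab bc) Rcb.
(* The peak seen from the side of [c]: [F] also preserves the reversed order. *)
apply: (order_preserving_no_strict_peak _ (fun x y => le y x) F c b a) Rab => //.
by move=> x x' y y'; exact: Fle.
Qed.

(** * From a weak ordering back to the properties of the operation *)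

Section MaxOrProj.
Variables (X : Type) (R : X -> X -> Prop).
Hypothesis hR : weak_ordering R.
Implicit Types (F : X -> X -> X) (le : X -> X -> Prop).

Lemma max_or_proj_flip F : max_or_proj R F -> max_or_proj R (fun x y => F y x).
Proof.
move=> [hmax hproj]; split=> [x y /hmax []//|x].
by case: (hproj x) => k; [right|left] => y z ? ?; exact: k.
Qed.

Lemma max_or_proj_quasitrivial F : max_or_proj R F -> quasitrivial F.
Proof.
move=> [hmax hproj] x y.
case: (weak_ordering_trichotomy X R hR x y) => [/hmax []|xy|/hmax []]; [by right| |by left].
by case: (hproj x) => k; [left|right]; apply: k => //; exact: sym_part_refl.
Qed.

Lemma max_or_proj_eq1 F x y : max_or_proj R F -> F x y = x -> R y x.
Proof.
move=> [hmax _] e; apply: contrapT => /(not_weak_ordering _ _ hR) xy.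
by case: (xy) => _; case; case: (hmax _ _ xy) => <- _; rewrite e;
  exact: weak_ordering_refl.
Qed.

Lemma max_or_proj_eq2 F x y : max_or_proj R F -> F x y = y -> R x y.
Proof. by move=> /max_or_proj_flip; exact: max_or_proj_eq1. Qed.

(** Both bracketings discard every argument outside the highest class among [x], [y], [z], then
    apply the single projection of that class to what is left. *)
Lemma max_or_proj_associative F : max_or_proj R F -> associative F.
Proof.
move=> hF x y z; have Fq := max_or_proj_quasitrivial _ hF.
have [hmax hproj] := hF.
have [xy|xy|yx] := weak_ordering_trichotomy X R hR x y.
- have [-> _] := hmax _ _ xy.
  case: (Fq y z) => e; rewrite e; first by case: (hmax _ _ xy).
  have /hmax [//] : asym_part R x z.
  exact: (asym_part_le_trans _ _ hR y) (max_or_proj_eq2 _ _ _ hF e).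
- have [yz|yz|zy] := weak_ordering_trichotomy X R hR y z.
  + have [e _] := hmax _ _ yz; rewrite e.
    have [] := hmax x z; first by apply: (le_asym_part_trans _ _ hR y) => //; case: xy.
    by case: (Fq x y) => -> ->.
  + have xz := sym_part_trans _ _ hR _ _ _ xy yz.
    have xx := sym_part_refl _ _ hR x.
    by case: (hproj x) => k; rewrite !k //; case: (Fq y z) => ->.
  + have [_ ->] := hmax _ _ zy.
    have zx : asym_part R z x by apply: (asym_part_le_trans _ _ hR y) => //; case: xy.
    have [_ ezy] := hmax _ _ zy; have [_ ezx] := hmax _ _ zx.
    by case: (Fq x y) => ->.
- have [_ exy] := hmax _ _ yx; rewrite exy.
  case: (Fq y z) => e; rewrite e // exy.
  have /hmax [_ ->//] : asym_part R z x.
  exact: (le_asym_part_trans _ _ hR y) (max_or_proj_eq1 _ _ _ hF e) _.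
Qed.

Lemma max_or_proj_monotone_left le F : total_ordering le ->
  weakly_single_peaked le R -> max_or_proj R F ->
  forall x x' y, le x x' -> le (F x y) (F x' y).
Proof.
move=> [tot tr anti] sp hF x x' y xx'.
have lt_of_nle s t : ~ le s t -> asym_part le t s by case: (tot s t).
have refl t : le t t by case: (tot t t).
have Fq := max_or_proj_quasitrivial _ hF.
have [<-|ne] := EM (x = x'); first exact: refl.
have lt_xx' : asym_part le x x' by split=> // x'x; apply/ne/anti.
(* Within one class, [y] cannot win against one element and lose against another from the same
   argument position. *)
have no_mix : sym_part R y x -> sym_part R y x' -> y <> x -> y <> x' ->
    (F x y = x /\ F x' y = y) \/ (F x y = y /\ F x' y = x') -> False.
  move=> yx yx' nyx nyx'; have yy := sym_part_refl _ _ hR y.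
  by case: hF => _ /(_ y) [] k; rewrite !k // => -[] [];
     congruence.
have neq s t : asym_part le s t -> s <> t by move=> st e; rewrite e in st; case: st.
(* Only two outcomes can fail: [y < x < x'] with [x' ≼ y ≼ x], or [x < x' < y] with [x ≼ y ≼ x']. In
   each, the middle element dominates the other two. *)
case: (Fq x y) => e; case: (Fq x' y) => e'; rewrite e e' //; apply: contrapT => /lt_of_nle lt.
- have Ryx := max_or_proj_eq1 _ _ _ hF e.
  have Rx'y := max_or_proj_eq2 _ _ _ hF e'.
  have [[]//|[_]|[yx xx's]] := sp _ _ _ lt lt_xx'.
    by case; exact: (weak_ordering_trans _ _ hR y).
  have /neq nyx' : asym_part le y x' := asym_part_le_trans _ _ (conj tot tr) x _ _ lt xx'.
  apply: no_mix => //; [exact: (sym_part_trans _ _ hR x)|exact: neq|by left].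
- have Rxy := max_or_proj_eq2 _ _ _ hF e.
  have Ryx' := max_or_proj_eq1 _ _ _ hF e'.
  have [[_]|[]//|[xx's x'y]] := sp _ _ _ lt_xx' lt.
    by case; exact: (weak_ordering_trans _ _ hR y).
  have yx' := sym_part_sym _ _ _ _ x'y.
  have /neq nxy : asym_part le x y :=
    le_asym_part_trans _ _ (conj tot tr) x' _ _ xx' lt.
  apply: no_mix => //; [|exact: nesym|exact/nesym/neq|by right].
  by apply: (sym_part_trans _ _ hR x') => //; exact: sym_part_sym.
Qed.

Lemma max_or_proj_order_preserving le F : total_ordering le ->
  weakly_single_peaked le R -> max_or_proj R F -> order_preserving le F.
Proof.
move=> hle sp hF x x' y y' xx' yy'; have [_ tr _] := hle.
apply: (tr _ (F x' y)); first exact: (max_or_proj_monotone_left _ _ hle sp hF).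
(* Monotonicity in the second argument is that of the flipped operation in its first. *)
exact: (max_or_proj_monotone_left _ _ hle sp (max_or_proj_flip _ hF) y y').
Qed.

End MaxOrProj.

Theorem theorem4p5 (X : Type) (hX : inhabited X) (le : X -> X -> Prop)
    (hle : total_ordering le) (F : X -> X -> X) :
  [/\ associative F, quasitrivial F & order_preserving le F] <->
  exists R : X -> X -> Prop,
    [/\ weak_ordering R,
        weakly_single_peaked le R &
        forall A B : set X, quotient_classes R A -> quotient_classes R B ->
          (A <> B -> eq_on_prod A B F (@max_wrt X R)) /\
          (A = B -> eq_on_prod A B F (@proj1_op X) \/
                    eq_on_prod A B F (@proj2_op X))].
Proof.
split=> [[FA Fq Fle]|[R [hR sp /(max_or_proj_classesP _ _ _ hR) hF]]].
  have hR := kimura_order_weak _ _ FA Fq.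
  exists (kimura_order X F); split=> //.
    by apply: kimura_order_weakly_single_peaked => //; case: hle.
  by apply/max_or_proj_classesP => //; exact: kimura_order_max_or_proj.
split.
- exact: max_or_proj_associative hF.
- exact: max_or_proj_quasitrivial hF.
- exact: max_or_proj_order_preserving hF.
Qed.
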